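(* Let $G$ be a graph on $n$ vertices. Then $\chi^\star_\ell(G) \le n$. Moreover, equality $\chi^\star_\ell(G)=n$ holds if and only if $G$ is $K_n$, the complete graph on $n$ vertices.
   Context: Graphs are finite and simple (and nonempty). A list-assignment $L$ of $G$ maps each vertex $v\in V(G)$ to a set $L(v)\subseteq\mathbb{N}$ of colours; it is a $k$-list-assignment if $|L(v)|=k$ for every $v$. A proper $L$-colouring is a map $c:V(G)\to\mathbb{N}$ with $c(v)\in L(v)$ for all $v$ and $c(u)\neq c(v)$ for every edge $uv$. A proper $L$-packing of $G$ of size $k$ is a collection of $k$ proper $L$-colourings $c_1,\dots,c_k$ that are mutually disjoint, i.e. $c_i(v)\neq c_j(v)$ for all $i\neq j$ and all $v\in V(G)$. The list packing number $\chi^\star_\ell(G)$ is the least $k$ such that $G$ admits a proper $L$-packing of size $k$ for every $k$-list-assignment $L$ of $G$. *)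

(* Defs.v *)
From mathcomp Require Import all_boot.
From mathcomp Require Import finmap.

Set Implicit Arguments.
Unset Strict Implicit.
Unset Printing Implicit Defensive.

(* A finite simple graph is a symmetric irreflexive adjacency relation on a
   finType of vertices; the predicates below take only the relation. *)

Definition complete_graph (T : finType) (adj : rel T) : Prop :=
  forall u v : T, u != v -> adj u v.

Definition list_assignment (T : finType) (k : nat) (L : T -> {fset nat}) : Prop :=
  forall v : T, #|` L v| = k.

Definition proper_list_colouring (T : finType) (adj : rel T)
    (L : T -> {fset nat}) (c : T -> nat) : Prop :=
  (forall v : T, c v \in L v) /\ (forall u v : T, adj u v -> c u <> c v).

Definition proper_list_packing (T : finType) (adj : rel T)
    (L : T -> {fset nat}) (k : nat) (c : 'I_k -> T -> nat) : Prop :=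
  (forall i : 'I_k, proper_list_colouring adj L (c i)) /\
  (forall (i j : 'I_k) (v : T), i != j -> c i v <> c j v).

Definition list_packable (T : finType) (adj : rel T) (k : nat) : Prop :=
  forall L : T -> {fset nat}, list_assignment k L ->
  exists c : 'I_k -> T -> nat, proper_list_packing adj L c.

(* The minimum ranges over positive k: every graph is vacuously list_packable
   for k = 0.  The number is given as a relation, so that asserting a value also
   asserts that the minimum exists. *)
Definition is_list_packing_number (T : finType) (adj : rel T) (k : nat) : Prop :=
  [/\ 0 < k, list_packable adj k &
      forall j : nat, 0 < j -> list_packable adj j -> k <= j].

Lemma is_list_packing_number_unique (T : finType) (adj : rel T) (k j : nat) :
  is_list_packing_number adj k -> is_list_packing_number adj j -> k = j.
Proof.
move=> [k0 pk mk] [j0 pj mj].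
by apply/eqP; rewrite eqn_leq mk // mj.
Qed.

(* Main.v *)
Require Import Defs.
From mathcomp Require Import all_boot.
From mathcomp Require Import finmap.
From mathcomp Require Import all_order all_algebra.
From mathcomp Require Import zify.
From Stdlib Require Import Classical_Prop.

Set Implicit Arguments.
Unset Strict Implicit.
Unset Printing Implicit Defensive.
Import Order.TTheory GRing.Theory Num.Theory.

(** A packing is an array: rows are vertices, columns are the colourings of the
    packing, and the row of [t] is an ordering of the list of [t].  An entry
    [x] in row [t] and column [i] is an edge [(t, x)] of colour [i] in the
    bipartite graph that joins each vertex to the members of its list.  A
    packing of a complete graph is therefore a proper edge-colouring of this
    bipartite graph.

    With lists of size [n] on [n] vertices, all degrees are at most [n], and
    Konig's edge-colouring theorem ([bipartite_edge_colouring]) gives the packing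
    ([complete_packing]); so the list packing number is at most [n].  If the
    graph is complete, then fewer than [n] equal colours do not even allow one
    colouring.

    The substance is that a graph with two nonadjacent vertices [u] and [v] is
    packable with lists of size [k = n - 1] ([near_complete_packing]).  Konig's
    theorem is obstructed only by the set [A] of symbols that lie in all the
    [n] lists; put [a = #|A|] and [r = k - a].  The remedy is to build the
    array from two blocks of columns ([two_block_packing]).  In the block of
    [a] columns, [u] and [v] both carry the symbols of [A], in the same order,
    so that [v] is a copy of [u] there and does not count; in the block of [r]
    columns they carry the rest of their lists and are treated as adjacent.
    Each block comes from Konig's theorem, once the edges [(t, x)] of the other
    [m = n - 2] rows are shared out so that every degree fits into its block.

    Such a distribution is a subgraph with prescribed bounds on its degrees.  It
    exists as soon as two Hall-type inequalities hold
    ([degree_constrained_subgraph]), and these are verified by counting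
    ([cut_rows], [cut_columns]); they hold because every list has exactly [k]
    members, so few symbols can be close to the maximal degree.  When [u] and
    [v] have the same list, one block is enough, with [v] a copy of [u].

    The theorem on subgraphs with bounded degrees also yields Konig's theorem:
    it provides a matching that covers all vertices of maximal degree, and
    this matching is taken as a colour class. *)

(** * Subgraphs of a bipartite graph with prescribed degree bounds *)

Section Cuts.
Local Open Scope ring_scope.
Variables (Ed A B : finType).
Implicit Types (l : Ed -> A) (r : Ed -> B) (E : {set Ed}).

(** A bipartite multigraph is a set [E] of abstract edges with two end maps
    [l : Ed -> A] and [r : Ed -> B]; exchanging [l] and [r] exchanges the two
    sides, so one-sided statements apply to both. *)
Definition degree (V : finType) (p : Ed -> V) E (a : V) : nat :=
  #|[set e in E | p e == a]|.

Lemma sum_degree (V : finType) (p : Ed -> V) E (S : {set V}) :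
  (\sum_(a in S) degree p E a)%N = #|[set e in E | p e \in S]|.
Proof.
rewrite -sum1_card (partition_big p (mem S)) => [|e] /=; last by rewrite inE => /andP[].
apply: eq_bigr => a aS; rewrite /degree -sum1_card; apply: eq_bigl => e.
by rewrite !inE; case: eqP => [->|]; rewrite ?aS ?andbT ?andbF.
Qed.

Definition crossing l r E (S : {set A}) (U : {set B}) : nat :=
  #|[set e in E | (l e \in S) && (r e \notin U)]|.

(** Necessary for a subgraph of [E] with degree at least [f] on [A] and at most
    [g] on [B]: the edges at [S] that do not cross end in [U], where [g]
    bounds their number.  The bounds are integers, since an induction that
    decreases them may pass below zero. *)
Definition cut_condition l r E (f : A -> int) (g : B -> int) : Prop :=
  forall (S : {set A}) (U : {set B}),
    \sum_(a in S) f a <= \sum_(b in U) g b + (crossing l r E S U)%:Z.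

Lemma crossingE l r E S U :
  (crossing l r E S U)%:Z = \sum_(e in E) ((l e \in S) && (r e \notin U) : nat)%:Z.
Proof.
rewrite /crossing -sum1_card (big_morph Posz PoszD (erefl _)).
rewrite big_mkcond [RHS]big_mkcond; apply: eq_bigr => e _.
by rewrite inE; case: (e \in E) => //=; case: (_ && _).
Qed.

Lemma crossingD1 l r E S U e : e \in E ->
  crossing l r E S U =
    ((l e \in S) && (r e \notin U) + crossing l r (E :\ e) S U)%N.
Proof.
move=> eE; rewrite /crossing (cardsD1 e) !inE eE; congr (_ + _)%N.
by apply: eq_card => e'; rewrite !inE andbA.
Qed.

Lemma crossing0 l r S U : crossing l r set0 S U = 0%N.
Proof. by apply: eq_card0 => e; rewrite !inE. Qed.

Lemma degree0 (V : finType) (p : Ed -> V) a : degree p set0 a = 0%N.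
Proof. by apply: eq_card0 => e; rewrite !inE. Qed.

Lemma degreeU1 (V : finType) (p : Ed -> V) E e a : e \notin E ->
  degree p (e |: E) a = ((p e == a) + degree p E a)%N.
Proof.
move=> eE; rewrite /degree (cardsD1 e) !inE eqxx /=; congr (_ + _)%N.
apply: eq_card => e'; rewrite !inE.
by case: eqVneq => [->|//]; rewrite (negbTE eE).
Qed.

Lemma sum_minus_indicator (V : finType) (f : V -> int) a (S : {set V}) :
  \sum_(b in S) (f b - (a == b : nat)%:Z) = \sum_(b in S) f b - (a \in S : nat)%:Z.
Proof.
rewrite big_split sumrN; congr (_ - _).
rewrite big_mkcond (bigD1 a) //= eqxx big1 ?addr0 => [|b ba].
  by case: (a \in S).
by rewrite eq_sym (negbTE ba); case: ifP.
Qed.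

Lemma sumIU (V : finType) (f : V -> int) (S S' : {set V}) :
  \sum_(a in S :&: S') f a + \sum_(a in S :|: S') f a =
  \sum_(a in S) f a + \sum_(a in S') f a.
Proof.
rewrite !(big_mkcond (fun a => a \in _)) -!big_split /=; apply: eq_bigr => a _.
by rewrite !inE; case: (a \in S); case: (a \in S'); rewrite ?addr0 ?add0r.
Qed.

Lemma sumDD (V : finType) (f g : V -> int) (S S' : {set V}) :
  (forall a, f a <= g a) ->
  \sum_(a in S) f a - \sum_(a in S') g a <=
  \sum_(a in S :\: S') f a - \sum_(a in S' :\: S) g a.
Proof.
move=> fg; rewrite !(big_mkcond (fun a => a \in _)) -!sumrB /=.
apply: ler_sum => a _; rewrite !inE; have := fg a.
by case: (a \in S); case: (a \in S') => /=; lia.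
Qed.

(** If deleting [e] breaks the cut condition at [(S, U)], and taking [e] into the
    subgraph breaks it at [(S', U')], then both cuts are tight, [e] goes from
    [S] to the complement of [U], and [e] avoids [S'] but ends in [U'].  As
    [crossing] is submodular, and strictly so on such an edge, the cuts
    [(S :&: S', U :&: U')] and [(S :|: S', U :|: U')] cannot both satisfy the
    condition. *)
Lemma uncross_same l r E f g e (S S' : {set A}) (U U' : {set B}) :
  cut_condition l r E f g -> e \in E ->
  \sum_(a in S) f a > \sum_(b in U) g b + (crossing l r (E :\ e) S U)%:Z ->
  \sum_(a in S') (f a - (l e == a : nat)%:Z) >
    \sum_(b in U') (g b - (r e == b : nat)%:Z) + (crossing l r (E :\ e) S' U')%:Z ->
  False.
Proof.
move=> cut eE; rewrite !sum_minus_indicator => lt1 lt2.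
have := cut S U; have := cut S' U'; rewrite !(crossingD1 _ _ _ _ eE).
have := cut (S :&: S') (U :&: U'); have := cut (S :|: S') (U :|: U').
rewrite !(crossingD1 _ _ _ _ eE) !inE.
have := sumIU f S S'; have := sumIU g U U'.
have : (crossing l r (E :\ e) (S :&: S') (U :&: U'))%:Z +
       (crossing l r (E :\ e) (S :|: S') (U :|: U'))%:Z <=
       (crossing l r (E :\ e) S U)%:Z + (crossing l r (E :\ e) S' U')%:Z.
  rewrite !crossingE -!big_split /=; apply: ler_sum => e' _; rewrite !inE.
  by case: (l e' \in S); case: (l e' \in S'); case: (r e' \in U); case: (r e' \in U').
move: lt1 lt2.
by case: (l e \in S); case: (l e \in S'); case: (r e \in U); case: (r e \in U') => /=; lia.
Qed.

End Cuts.

Section Factor.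
Local Open Scope ring_scope.
Variables (Ed : finType).
Implicit Types (E : {set Ed}).

(** The same exchange for two cuts that bound the degrees from below on opposite
    sides; the conflict now shows in [(S :\: U', U :\: S')] and
    [(S' :\: U, U' :\: S)]. *)
Lemma uncross_opposite (A B : finType) (l : Ed -> A) (r : Ed -> B)
    E fA gA fB gB e
    (S U' : {set A}) (S' U : {set B}) :
  (forall a, fA a <= gA a) -> (forall b, fB b <= gB b) ->
  cut_condition l r E fA gB -> cut_condition r l E fB gA -> e \in E ->
  \sum_(a in S) fA a > \sum_(b in U) gB b + (crossing l r (E :\ e) S U)%:Z ->
  \sum_(b in S') (fB b - (r e == b : nat)%:Z) >
    \sum_(a in U') (gA a - (l e == a : nat)%:Z) + (crossing r l (E :\ e) S' U')%:Z ->
  False.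
Proof.
move=> fgA fgB cutA cutB eE; rewrite !sum_minus_indicator => lt1 lt2.
have := cutA S U; have := cutB S' U'; rewrite !(crossingD1 _ _ _ _ eE).
have := cutA (S :\: U') (U :\: S'); have := cutB (S' :\: U) (U' :\: S).
rewrite !(crossingD1 _ _ _ _ eE) !inE.
have := sumDD S U' fgA; have := sumDD S' U fgB.
have : (crossing l r (E :\ e) (S :\: U') (U :\: S'))%:Z +
       (crossing r l (E :\ e) (S' :\: U) (U' :\: S))%:Z <=
       (crossing l r (E :\ e) S U)%:Z + (crossing r l (E :\ e) S' U')%:Z.
  rewrite !crossingE -!big_split /=; apply: ler_sum => e' _; rewrite !inE.
  by case: (l e' \in S); case: (l e' \in U'); case: (r e' \in U); case: (r e' \in S').
move: lt1 lt2.
by case: (l e \in S); case: (l e \in U'); case: (r e \in U); case: (r e \in S') => /=; lia.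
Qed.

Definition degrees_within (V : finType) (p : Ed -> V) (H : {set Ed})
    (f g : V -> int) : Prop :=
  forall a, f a <= (degree p H a)%:Z <= g a.

Lemma cut_condition_dec (A B : finType) (l : Ed -> A) (r : Ed -> B) E f g :
  cut_condition l r E f g \/
  exists (S : {set A}) (U : {set B}),
    \sum_(b in U) g b + (crossing l r E S U)%:Z < \sum_(a in S) f a.
Proof.
have [/existsP[S /existsP[U]] | no] := boolP [exists S : {set A}, exists U : {set B},
  \sum_(b in U) g b + (crossing l r E S U)%:Z < \sum_(a in S) f a].
  by right; exists S, U.
left=> S U; rewrite leNgt; apply: contra no => lt.
by apply/existsP; exists S; apply/existsP; exists U.
Qed.

(** By induction on the edges: an edge that can neither be deleted nor be taken
    into [H] yields two violated cuts that the uncrossing lemmas exclude. *)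
Theorem degree_constrained_subgraph (A B : finType) (l : Ed -> A) (r : Ed -> B)
    E fA gA fB gB :
  (forall a, fA a <= gA a) -> (forall b, fB b <= gB b) ->
  cut_condition l r E fA gB -> cut_condition r l E fB gA ->
  exists H : {set Ed},
    [/\ H \subset E, degrees_within l H fA gA & degrees_within r H fB gB].
Proof.
move: {2}#|E| (leqnn #|E|) => n.
elim: n => [|n IHn] in E fA gA fB gB *.
  rewrite leqn0 cards_eq0 => /eqP-> _ _ cutA cutB; exists set0; split=> //.
    move=> a; have := cutA [set a] set0; have := cutB set0 [set a].
    by rewrite !big_set0 !big_set1 !crossing0 degree0; lia.
  move=> b; have := cutA set0 [set b]; have := cutB [set b] set0.
  by rewrite !big_set0 !big_set1 !crossing0 degree0; lia.
move=> leE fgA fgB cutA cutB.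
have [E0|[e eE]] := set_0Vmem E; first by apply: IHn => //; rewrite E0 cards0.
have leE' : (#|E :\ e| <= n)%N by move: leE; rewrite (cardsD1 e) eE.
pose fA' a := fA a - (l e == a : nat)%:Z; pose gA' a := gA a - (l e == a : nat)%:Z.
pose fB' b := fB b - (r e == b : nat)%:Z; pose gB' b := gB b - (r e == b : nat)%:Z.
have include : cut_condition l r (E :\ e) fA' gB' -> cut_condition r l (E :\ e) fB' gA' ->
    exists H : {set Ed},
    [/\ H \subset E, degrees_within l H fA gA & degrees_within r H fB gB].
  move=> cA cB; have [|||H [HE dA dB]] := IHn (E :\ e) fA' gA' fB' gB' _ _ _ cA cB => //.
  - by move=> a; rewrite lerD2r.
  - by move=> a; rewrite lerD2r.
  have eH : e \notin H by apply/negP => /(subsetP HE); rewrite !inE eqxx.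
  exists (e |: H); split.
  - by rewrite subUset sub1set eE (subset_trans HE) // subD1set.
  - by move=> a; have := dA a; rewrite degreeU1 // /fA' /gA'; lia.
  - by move=> a; have := dB a; rewrite degreeU1 // /fB' /gB'; lia.
have delete : cut_condition l r (E :\ e) fA gB -> cut_condition r l (E :\ e) fB gA ->
    exists H : {set Ed},
    [/\ H \subset E, degrees_within l H fA gA & degrees_within r H fB gB].
  move=> cA cB; have [//|//|//|H [HE dA dB]] := IHn (E :\ e) fA gA fB gB _ _ _ cA cB.
  by exists H; split=> //; rewrite (subset_trans HE) // subD1set.
have [iA|[S' [U' iA]]] := cut_condition_dec l r (E :\ e) fA' gB'; last first.
  have [dA|[S [U dA]]] := cut_condition_dec l r (E :\ e) fA gB; last first.
    by case: (uncross_same cutA eE dA iA).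
  have [dB|[S [U dB]]] := cut_condition_dec r l (E :\ e) fB gA; last first.
    by case: (uncross_opposite fgB fgA cutB cutA eE dB iA).
  exact: delete.
have [iB|[S' [U' iB]]] := cut_condition_dec r l (E :\ e) fB' gA'; last first.
  have [dA|[S [U dA]]] := cut_condition_dec l r (E :\ e) fA gB; last first.
    by case: (uncross_opposite fgA fgB cutA cutB eE dA iB).
  have [dB|[S [U dB]]] := cut_condition_dec r l (E :\ e) fB gA; last first.
    by case: (uncross_same cutB eE dB iB).
  exact: delete.
exact: include.
Qed.
End Factor.

(** * Konig's edge-colouring theorem *)

Section Konig.
Local Open Scope ring_scope.
Variables (Ed : finType).
Implicit Types (E : {set Ed}).

(** The [k.+1] edges at each vertex of maximal degree in [S] either cross or end
    in [U], where at most [k.+1] edges meet at each vertex. *)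
Lemma cut_condition_max_degree (A B : finType) (l : Ed -> A) (r : Ed -> B) E k :
  (forall b, degree r E b <= k.+1)%N ->
  cut_condition l r E (fun a => (degree l E a == k.+1 : nat)%:Z) (fun=> 1).
Proof.
move=> dB S U.
rewrite -(big_morph Posz PoszD (erefl _)) sumr_const pmulrn intz.
rewrite -PoszD lez_nat -(@leq_pmul2l k.+1) // big_distrr /=.
set S' := [set a in S | degree l E a == k.+1].
have -> : (\sum_(a in S) k.+1 * (degree l E a == k.+1) = \sum_(a in S') degree l E a)%N.
  rewrite big_mkcond [RHS]big_mkcond; apply: eq_bigr => a _; rewrite inE.
  by case: (a \in S) => //=; case: eqP => [->|]; rewrite ?muln1 ?muln0.
rewrite sum_degree mulnDr.
apply: leq_trans (_ : \sum_(b in U) degree r E b + crossing l r E S U <= _)%N.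
  rewrite sum_degree -cardsUI (leq_trans _ (leq_addr _ _)) //.
  apply/subset_leq_card/subsetP => e; rewrite !inE => /andP[-> /andP[-> _]].
  by case: (r e \in U).
rewrite leq_add ?leq_pmull //.
by rewrite mulnC -sum_nat_const leq_sum.
Qed.

(** Peel off a matching that covers all vertices of maximal degree, and
    recurse. *)
Lemma bipartite_edge_colouring (A B : finType) (l : Ed -> A) (r : Ed -> B) E k :
  (forall a, degree l E a <= k)%N -> (forall b, degree r E b <= k)%N ->
  exists col : Ed -> nat,
    {in E, forall e, (col e < k)%N} /\
    {in E &, forall e e', e != e' -> col e = col e' -> l e != l e' /\ r e != r e'}.
Proof.
elim: k E => [|k IHk] E dA dB.
  have E0 e : e \in E = false.
    apply/negbTE/negP => eE; have := dA (l e).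
    by rewrite leqn0 cards_eq0 => /eqP/setP/(_ e); rewrite !inE eE eqxx.
  by exists (fun=> 0%N); split=> e; rewrite E0.
have [||||M [ME MA MB]] := @degree_constrained_subgraph _ _ _ l r E
    (fun a => (degree l E a == k.+1 : nat)%:Z) (fun=> 1)
    (fun b => (degree r E b == k.+1 : nat)%:Z) (fun=> 1).
- by move=> a; case: (_ == _).
- by move=> b; case: (_ == _).
- exact: cut_condition_max_degree.
- exact: cut_condition_max_degree.
have degD (V : finType) (p : Ed -> V) a :
    (degree p (E :\: M) a = degree p E a - degree p M a)%N.
  rewrite /degree -(cardsID M [set e in E | p e == a]).
  rewrite (_ : _ :&: M = [set e in M | p e == a]); last first.
    apply/setP => e; rewrite !inE; case: (boolP (e \in M)) => [/(subsetP ME)->|_] //=.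
      by rewrite andbT.
    by rewrite !andbF.
  rewrite addKn; apply: eq_card => e; rewrite !inE.
  by case: (e \in E); case: (e \in M); rewrite ?andbF.
have [||col [colk colP]] := IHk (E :\: M).
- by move=> a; rewrite degD; have := MA a; have := dA a; case: eqP; lia.
- by move=> b; rewrite degD; have := MB b; have := dB b; case: eqP; lia.
have uniqM (V : finType) (p : Ed -> V) f : degrees_within p M f (fun=> 1) ->
    {in M &, forall e e', e != e' -> p e != p e'}.
  move=> Mp e e' eM e'M; apply: contraNneq => pe.
  have /andP[_] := Mp (p e); rewrite lez_nat => /card_le1_eqP le1.
  by apply/eqP/le1; rewrite inE ?eM ?e'M ?pe eqxx.
exists (fun e => if e \in M then k else col e); split.
  move=> e eE /=; case: ifP => // eM; apply: ltnW; rewrite ltnS; apply: colk.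
  by rewrite inE eM.
move=> e e' eE e'E ee' /=.
case: ifP => eM; case: ifP => e'M eqc.
- by split; [apply: (uniqM _ _ _ MA)|apply: (uniqM _ _ _ MB)].
- by have := colk e'; rewrite inE e'M e'E -eqc ltnn => /(_ isT).
- by have := colk e; rewrite inE eM eE eqc ltnn => /(_ isT).
- by apply: colP => //; rewrite inE ?eM ?e'M.
Qed.
End Konig.

(** * Arrays of symbols *)

Section Arrays.
Local Open Scope ring_scope.
Variables T X : finType.

(** An edge-colouring read as an array.  The map [rho] lets several rows of the
    array show the same row of the graph; the columns are then proper only
    between rows with different images. *)
Lemma latin_array (E : {set T * X}) k (rho : T -> T) :
  (forall t, degree fst E (rho t) = k) ->
  (forall t, degree fst E t <= k)%N -> (forall x, degree snd E x <= k)%N ->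
  exists c : 'I_k -> T -> X,
    [/\ forall i t, (rho t, c i t) \in E,
        forall i j t, i != j -> c i t != c j t &
        forall i t t', rho t != rho t' -> c i t != c i t'].
Proof.
move=> drho dT dX; have [col [colk colP]] := bipartite_edge_colouring dT dX.
(* A row of degree [k] meets each of the [k] edge colours. *)
have ex_cell (i : 'I_k) t : exists x, (rho t, x) \in E /\ col (rho t, x) = i.
  case: k i colk drho {dT dX} => [[]//|k] i colk drho.
  pose R := [set e in E | e.1 == rho t].
  have inj : {in R &, injective (fun e => inord (col e) : 'I_k.+1)}.
    move=> e e'; rewrite !inE => /andP[eE /eqP e1] /andP[e'E /eqP e1'] /(congr1 val) /=.
    rewrite !inordK ?colk // => eqc; apply/eqP; apply: contraT => ee'.
    by have [] := colP _ _ eE e'E ee' eqc; rewrite e1 e1' eqxx.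
  have /eqP full : (fun e => inord (col e) : 'I_k.+1) @: R == setT.
    by rewrite eqEcard subsetT card_in_imset // cardsT card_ord -(drho t) leqnn.
  have : i \in (fun e => inord (col e) : 'I_k.+1) @: R by rewrite full.
  case/imsetP => -[t' x]; rewrite inE /= => /andP[tE /eqP tt'] ->; rewrite -tt'.
  by exists x; rewrite inordK ?colk.
have [c cP] := fin_all_exists (fun i => fin_all_exists (ex_cell i)).
exists c; split=> [i t|i j t|i t t']; first by have [] := cP i t.
  apply: contraNneq => eqc; have [_ ci] := cP i t; have [_ cj] := cP j t.
  by apply/eqP/val_inj; rewrite /= -ci -cj eqc.
move=> tt'; apply/eqP => eqc; have [iE ci] := cP i t; have [iE' ci'] := cP i t'.
have [||_] := colP _ _ iE iE'; rewrite ?ci ?ci' // ?xpair_eqE /= ?eqc ?eqxx ?andbT //.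
Qed.

Lemma degreeU (V Ed : finType) (p : Ed -> V) (E F : {set Ed}) a : [disjoint E & F] ->
  degree p (E :|: F) a = (degree p E a + degree p F a)%N.
Proof.
move=> dis; rewrite /degree -cardsUI [X in (_ + X)%N]eq_card0 => [|e]; last first.
  rewrite !inE; case: (boolP (e \in E)) => //= eE.
  by rewrite (disjointFr dis eE) andbF.
by rewrite addn0; apply: eq_card => e; rewrite !inE andb_orl.
Qed.

Lemma degree_fst (E : {set T * X}) t : degree fst E t = #|[set x | (t, x) \in E]|.
Proof.
rewrite /degree -[RHS](@card_imset _ _ (pair t)) => [|x y [] //].
apply: eq_card => -[t' x]; rewrite !inE /=; apply/andP/imsetP.
  by case=> tE /eqP<-; exists x; rewrite ?inE.
by case=> y; rewrite inE => yE [-> ->].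
Qed.

Lemma degree_snd (E : {set T * X}) x : degree snd E x = #|[set t | (t, x) \in E]|.
Proof.
rewrite /degree -[RHS](@card_imset _ _ (fun t => (t, x))) => [|t t' [] //].
apply: eq_card => -[t x']; rewrite !inE /=; apply/andP/imsetP.
  by case=> tE /eqP<-; exists t; rewrite ?inE.
by case=> t'; rewrite inE => yE [-> ->].
Qed.

Definition list_edges (M : T -> {set X}) : {set T * X} := [set e | e.2 \in M e.1].

Lemma complete_packing (M : T -> {set X}) k : #|T| = k -> (forall t, #|M t| = k) ->
  exists c : 'I_k -> T -> X,
    [/\ forall i t, c i t \in M t,
        forall i j t, i != j -> c i t != c j t &
        forall i t t', t != t' -> c i t != c i t'].
Proof.
move=> cardT cardM.
have dT t : degree fst (list_edges M) t = k.
  by rewrite degree_fst -(cardM t); apply: eq_card => x; rewrite !inE.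
have dX x : (degree snd (list_edges M) x <= k)%N by rewrite degree_snd -cardT max_card.
have dT' t : (degree fst (list_edges M) t <= k)%N by rewrite dT.
have [c [cE cd cp]] := latin_array (rho := id) dT dT' dX.
by exists c; split=> // i t; have := cE i t; rewrite inE.
Qed.

(** [H] is the part of the inner edges that goes to the block of [#|A|] columns.
    There [u] takes all of [A] and [v] copies [u], so that a symbol of [A]
    needs one cell besides those of [H].  In the block of [r] columns a symbol
    keeps its remaining edges; the two edges that join a symbol of [A] to [u]
    and [v] have been used, which explains the term [2 * (x \in A)]. *)
Lemma two_block_packing (M : T -> {set X}) (u v : T) (A : {set X})
    (H : {set T * X}) k r :
  u != v -> k = (r + #|A|)%N -> (forall t, #|M t| = k) ->
  A \subset M u -> A \subset M v ->
  H \subset [set e in list_edges M | e.1 \notin [set u; v]] ->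
  (forall t, t \notin [set u; v] -> degree fst H t = #|A|) ->
  (forall x, degree snd H x + (x \in A) <= #|A|)%N ->
  (forall x, degree snd (list_edges M) x <= degree snd H x + 2 * (x \in A) + r)%N ->
  exists c : 'I_k -> T -> X,
    [/\ forall i t, c i t \in M t,
        forall i j t, i != j -> c i t != c j t &
        forall i t t', t != t' -> ~~ [&& t \in [set u; v] & t' \in [set u; v]] ->
          c i t != c i t'].
Proof.
move=> uv -> cardM Au Av HE Hfst Hsnd Esnd.
pose row t := [set e : T * X | (e.1 == t) && (e.2 \in A)].
have row_fst t t' : degree fst (row t) t' = ((t == t') * #|A|)%N.
  rewrite degree_fst eq_sym; case: eqP => [->|/eqP tt'].
    by rewrite mul1n; apply: eq_card => x; rewrite !inE eqxx.
  by apply: eq_card0 => x; rewrite !inE (negbTE tt').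
have row_snd t x : degree snd (row t) x = (x \in A).
  rewrite degree_snd; case: (boolP (x \in A)) => xA.
    by rewrite -[RHS](cards1 t); apply: eq_card => t'; rewrite !inE xA andbT.
  by apply: eq_card0 => t'; rewrite !inE (negbTE xA) andbF.
have Hrow e : e \in H -> (e.1 != u) && (e.1 != v).
  by move/(subsetP HE); rewrite !inE negb_or => /andP[].
have disHu : [disjoint H & row u].
  rewrite disjoint_subset; apply/subsetP => e /Hrow; rewrite !inE.
  by case: (e.1 == u).
have disuv : [disjoint H :|: row u & row v].
  rewrite disjoint_subset; apply/subsetP => e; rewrite !inE.
  case/orP => [/Hrow|/andP[/eqP-> _]]; last by rewrite (negbTE uv).
  by case: (e.1 == v); rewrite ?andbF.
pose E2 := H :|: row u.
have E2fst t : degree fst E2 t = (degree fst H t + (u == t) * #|A|)%N.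
  by rewrite degreeU // row_fst.
have E2snd x : (degree snd E2 x <= #|A|)%N by rewrite degreeU // row_snd.
pose rho t := if t == v then u else t.
have Huv t : t \in [set u; v] -> degree fst H t = 0%N.
  move=> tuv; apply: eq_card0 => e; rewrite !inE.
  case: (boolP (e \in H)) => //= /Hrow; apply: contraTF => /eqP->.
  by move: tuv; rewrite !inE; case/orP=> ->; rewrite ?andbF.
have [||c2 [c2E c2d c2p]] := @latin_array E2 #|A| rho _ _ E2snd.
- move=> t; rewrite E2fst /rho; case: ifP => tv.
    by rewrite Huv ?inE ?eqxx // mul1n.
  case: (eqVneq u t) => [<-|ut]; first by rewrite Huv ?inE ?eqxx // mul1n.
  by rewrite Hfst ?addn0 // !inE tv orbF eq_sym.
- move=> t; rewrite E2fst; case: (boolP (t \in [set u; v])) => tuv.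
    by rewrite Huv //; case: (u == t); rewrite ?mul1n.
  rewrite Hfst //; move: tuv; rewrite !inE negb_or eq_sym => /andP[/negbTE-> _].
  by rewrite addn0.
pose E12 := E2 :|: row v; pose E1 := list_edges M :\: E12.
have E12E : E12 \subset list_edges M.
  rewrite !subUset; apply/andP; split; first (apply/andP; split).
  - by apply/subsetP => e /(subsetP HE); rewrite inE => /andP[].
  - by apply/subsetP => e; rewrite !inE => /andP[/eqP-> /(subsetP Au)].
  - by apply/subsetP => e; rewrite !inE => /andP[/eqP-> /(subsetP Av)].
have E1deg (V : finType) (p : T * X -> V) a :
    (degree p (list_edges M) a = degree p E1 a + (degree p E2 a + degree p (row v) a))%N.
  rewrite -degreeU // -degreeU; last first.
    by rewrite disjoint_sym disjoints_subset subsetC subsetDr.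
  by rewrite setUC -{1}(setID (list_edges M) E12) (setIidPr E12E).
have Efst t : degree fst (list_edges M) t = (r + #|A|)%N.
  by rewrite degree_fst -(cardM t); apply: eq_card => x; rewrite !inE.
have E1fst t : degree fst E1 t = r.
  have := E1deg _ fst t; rewrite Efst E2fst row_fst.
  case: (boolP (t \in [set u; v])) => tuv.
    rewrite (Huv _ tuv); move: tuv; rewrite !inE ![t == _]eq_sym => /orP[]/eqP<-.
      by rewrite eqxx eq_sym (negbTE uv); lia.
    by rewrite eqxx (negbTE uv); lia.
  rewrite (Hfst _ tuv); move: tuv; 
  rewrite !inE ![t == _]eq_sym negb_or => /andP[/negbTE-> /negbTE->].
  lia.
have E1snd x : (degree snd E1 x <= r)%N.
  have := E1deg _ snd x; rewrite degreeU // !row_snd; have := Esnd x; lia.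
have E1fst' t : (degree fst E1 t <= r)%N by rewrite E1fst.
have [c1 [c1E c1d c1p]] := latin_array (rho := id) E1fst E1fst' E1snd.
have c2row i t : (t, c2 i t) \in E12.
  have := c2E i t; rewrite /rho; case: eqP => [->|_]; last by move=> tE; rewrite inE tE.
  rewrite inE => /orP[/Hrow|]; first by rewrite eqxx.
  by rewrite !inE !eqxx /= => ->; rewrite orbT.
have c12 i j t : c1 i t != c2 j t.
  by have := c1E i t; rewrite inE => /andP[nE _]; apply: contraNneq nE => ->.
exists (fun i => match split i with inl j => c1 j | inr j => c2 j end); split.
- move=> i t; case: (split i) => j.
    by have := c1E j t; rewrite !inE => /andP[].
  by have := subsetP E12E _ (c2row j t); rewrite inE.
- move=> i j t; rewrite -(inj_eq (can_inj (@splitK _ _))).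
  case: (split i) => i'; case: (split j) => j' ij //; try exact: c12.
  + by apply: c1d.
  + by rewrite eq_sym.
  + by apply: c2d.
- move=> i t t' tt' ntt'; case: (split i) => j; first exact: c1p.
  apply: c2p; move: tt' ntt'; rewrite /rho !inE.
  case: (eqVneq t v) => [->|tv]; case: (eqVneq t' v) => [->|t'v];
    rewrite ?eqxx ?orbT ?orbF ?andbT //.
  by rewrite eq_sym.
Qed.
End Arrays.

(** * Lists that are one shorter than the number of vertices *)

Section NearComplete.
Local Open Scope ring_scope.
Variables (T X : finType) (M : T -> {set X}) (u v : T) (m : nat).
Hypotheses (uv : u != v) (cardT : #|T| = m.+2) (cardM : forall t, #|M t| = m.+1).

Let W : {set T} := ~: [set u; v].
Definition occurrences (S : {set T}) (x : X) : nat := #|[set t in S | x \in M t]|.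
Definition common : {set X} := [set x | [forall t, x \in M t]].
Local Notation A := common.
Local Notation a := #|A|.
Definition inner_edges : {set T * X} :=
  [set e in list_edges M | e.1 \notin [set u; v]].
Local Notation EW := inner_edges.

Lemma cardW : #|W| = m.
Proof. by rewrite /W; have := cardsC [set u; v]; rewrite cards2 uv cardT; lia. Qed.

Lemma sum_occurrences S (Q : {set X}) :
  (\sum_(x in Q) occurrences S x = \sum_(t in S) #|M t :&: Q|)%N.
Proof.
have occE x : occurrences S x = (\sum_(t in S) (x \in M t))%N.
  rewrite /occurrences -sum1_card big_mkcond [RHS]big_mkcond; apply: eq_bigr => t _.
  by rewrite inE; case: (t \in S) => //=; case: (x \in M t).
rewrite (eq_bigr _ (fun x _ => occE x)) exchange_big /=; apply: eq_bigr => t _.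
rewrite -sum1_card big_mkcond [RHS]big_mkcond; apply: eq_bigr => x _.
by rewrite inE andbC; case: (x \in Q) => //=; case: (x \in M t).
Qed.

Lemma crossing_fst S U :
  crossing fst snd EW S U = (\sum_(x in ~: U) occurrences (S :&: W) x)%N.
Proof.
pose E' := [set e in EW | e.1 \in S].
have E'snd x : degree snd E' x = occurrences (S :&: W) x.
  rewrite degree_snd; apply: eq_card => t; rewrite !inE.
  by case: (t \in S); case: (x \in M t); rewrite ?andbF ?andbT.
rewrite -(eq_bigr _ (fun x _ => E'snd x)) sum_degree; apply: eq_card => e.
by rewrite !inE !andbA.
Qed.

Lemma crossing_snd S U :
  crossing snd fst EW S U = (\sum_(x in S) occurrences (W :\: U) x)%N.
Proof.
pose E' := [set e in EW | e.1 \notin U].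
have E'snd x : degree snd E' x = occurrences (W :\: U) x.
  rewrite degree_snd; apply: eq_card => t; rewrite !inE.
  by case: (t \in U); case: (x \in M t); rewrite ?andbF ?andbT.
rewrite -(eq_bigr _ (fun x _ => E'snd x)) sum_degree; apply: eq_card => e.
by rewrite !inE -!andbA [(e.1 \notin U) && _]andbC.
Qed.

Lemma occurrences_split (S U : {set T}) x :
  occurrences S x = (occurrences (S :&: U) x + occurrences (S :\: U) x)%N.
Proof.
rewrite /occurrences -(cardsID U [set t in S | x \in M t]); congr (_ + _)%N;
  apply: eq_card => t; rewrite !inE.
  by rewrite andbAC.
by rewrite andbA.
Qed.

Lemma occurrences_le S x : (occurrences S x <= #|S|)%N.
Proof. by apply/subset_leq_card/subsetP => t; rewrite inE => /andP[]. Qed.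

Lemma occurrences_common S x : x \in A -> occurrences S x = #|S|.
Proof.
rewrite inE => /forallP xA; apply: eq_card => t; by rewrite inE xA andbT.
Qed.

Lemma common_sub t : A \subset M t.
Proof. by apply/subsetP => x; rewrite inE => /forallP. Qed.

Lemma degree_list_edges x :
  degree snd (list_edges M) x = (occurrences W x + (x \in M u) + (x \in M v))%N.
Proof.
rewrite degree_snd (_ : #|_| = occurrences setT x); last first.
  by apply: eq_card => t; rewrite !inE.
rewrite (occurrences_split setT W) setTI setTD setCK -addnA; congr (_ + _)%N.
rewrite /occurrences -sum1_card big_mkcond (bigD1 u) //= (bigD1 v) ?(eq_sym v) //=.
rewrite big1 => [|t /andP[/negbTE tu /negbTE tv]].
  by rewrite !inE !eqxx orbT /=; case: (x \in M u); case: (x \in M v).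
by rewrite !inE tu tv.
Qed.

Lemma degree_list_edges_noncommon x :
  x \notin A -> (degree snd (list_edges M) x <= m.+1)%N.
Proof.
rewrite inE negb_forall => /existsP[t xt]; rewrite -ltnS -cardT degree_snd.
rewrite -cardsT; apply/proper_card/properP; split; first exact: subsetT.
by exists t; rewrite ?inE.
Qed.

Lemma card_common_lt t t' : M t != M t' -> (a < m.+1)%N.
Proof.
move=> ne; rewrite ltnNge; apply: contra ne => le.
have eqA s : A = M s by apply/eqP; rewrite eqEcard common_sub cardM.
by rewrite -!eqA.
Qed.

(** The degree bounds for the part [H] of the inner edges that goes to the block
    of [a] columns: a row fills that block, a symbol has at most [a] cells there,
    one of them in the row of [u] for a common symbol, and the edges left over
    for the other [r] columns are at most [r] at each symbol.  The last bound
    subtracts the two edges that join a common symbol to [u] and [v]. *)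
Let r := (m.+1 - a)%N.
Let row_target t : int := ((t \notin [set u; v]) * a)%N.
Let symbol_upper x : int := a%:Z - (x \in A : nat)%:Z.
Let symbol_lower x : int := (degree snd (list_edges M) x)%:Z - r%:Z - (2 * (x \in A))%N%:Z.

Lemma sum_row_target (S : {set T}) : \sum_(t in S) row_target t = (#|S :&: W| * a)%N.
Proof.
rewrite /row_target -(big_morph Posz PoszD (erefl _)); congr Posz.
rewrite -big_distrl /= ; congr (_ * _)%N.
rewrite -sum1_card big_mkcond [RHS]big_mkcond; apply: eq_bigr => t _.
by rewrite !inE; case: (t \in S) => //=; case: (_ || _).
Qed.

Hypothesis Muv : M u != M v.

(** The constant weights [(a - 1) / m] on the edges at a common symbol and [a / m]
    on the other edges respect the bounds [symbol_upper] and have the sum [a] in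
    each row; the proof is the resulting estimate, multiplied by [m]. *)
Lemma cut_rows : cut_condition fst snd EW row_target symbol_upper.
Proof.
move=> S U; rewrite sum_row_target crossing_fst; set S' := S :&: W; set mu := #|S'|.
have am : (a <= m)%N by rewrite -ltnS (card_common_lt Muv).
have mum : (mu <= m)%N by rewrite -cardW subset_leq_card // subsetIr.
have symbol_upper_ge0 x : 0 <= symbol_upper x.
  rewrite /symbol_upper; case: (boolP (x \in A)) => xA /=; last by rewrite subr0.
  by have : (0 < a)%N by [apply/card_gt0P; exists x]; lia.
have [a0|a_gt0] := posnP a.
  by rewrite a0 muln0 addr_ge0 // sumr_ge0.
have m_gt0 : 0 < m%:Z by lia.
rewrite -(ler_pM2l m_gt0) (big_morph Posz PoszD (erefl _)).
rewrite big_mkcond [X in _ + X]big_mkcond -big_split mulr_sumr /=.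
have sumA : \sum_x (a%:Z * (occurrences S' x)%:Z - (x \in A : nat)%:Z * mu%:Z) =
    m%:Z * (mu * a)%N%:Z.
  rewrite big_split /= sumrN -mulr_sumr -mulr_suml -!(big_morph Posz PoszD (erefl _)).
  have -> : (\sum_x occurrences S' x = mu * m.+1)%N.
    rewrite (eq_bigl (fun x => x \in [set: X])) => [|x]; last by rewrite inE.
    rewrite sum_occurrences (eq_bigr (fun=> m.+1)) ?sum_nat_const // => t _.
    by rewrite setIT cardM.
  have -> : (\sum_x (x \in A) = a)%N.
    by rewrite -sum1_card [RHS]big_mkcond; apply: eq_bigr => x _; case: (x \in A).
  by lia.
rewrite -sumA; apply: ler_sum => x _; rewrite in_setC.
have dmu := occurrences_le S' x; rewrite -/mu in dmu.
have h1 : 0 <= (a%:Z - 1) * (m%:Z - mu%:Z) by apply: mulr_ge0; lia.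
have h2 : 0 <= a%:Z * (m%:Z - (occurrences S' x)%:Z) by apply: mulr_ge0; lia.
have h3 : 0 <= (m%:Z - a%:Z) * (occurrences S' x)%:Z by apply: mulr_ge0; lia.
case: (boolP (x \in U)) => xU /=; rewrite ?addr0 ?add0r /symbol_upper;
  case: (boolP (x \in A)) => xA /=;
  rewrite ?(occurrences_common _ xA) -/mu in h2 h3 *; lia.
Qed.

(** After the crossing edges are subtracted, a symbol [x] of [S] contributes
    [tau x], its occurrences in the lists of [u], [v] and the inner rows of [U],
    minus what the block of [r] columns can hold.  Let [mu] be the number of
    these rows; the claim is that the sum of [tau] is at most [mu * a].  Common
    symbols contribute [mu - r] each, and the others, [Y], at most [a] each.

    If [r <= mu], then [r * a] must bound the sum over [Y].  This is clear if
    [#|Y| <= r]; otherwise it follows from the total number [r * (mu + 2)] of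
    occurrences of noncommon symbols, since [mu <= m = a + r - 1].

    If [mu < r], then [mu * a] must bound the sum over [Y], and only [a > 0] is at
    issue.  If [mu + 1 < r], no term is positive.  If [mu + 1 = r], the only
    positive terms, equal to 1, come from noncommon symbols in both lists of [u]
    and [v]; as these lists differ, there are at most [r - 1 = mu] of them. *)
Lemma cut_columns : cut_condition snd fst EW symbol_lower row_target.
Proof.
move=> S U; rewrite sum_row_target crossing_snd; set U' := U :&: W; set mu := #|U'|.
have am : (a <= m)%N by rewrite -ltnS (card_common_lt Muv).
have mum : (mu <= m)%N by rewrite -cardW subset_leq_card // subsetIr.
pose tau x : int := (occurrences U' x + (x \in M u) + (x \in M v))%N%:Z - r%:Z
                    - (2 * (x \in A))%N%:Z.
have tauE x : symbol_lower x = tau x + (occurrences (W :\: U) x)%:Z.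
  rewrite /symbol_lower /tau degree_list_edges (occurrences_split W U) [W :&: U]setIC -/U'.
  lia.
rewrite (eq_bigr _ (fun x _ => tauE x)) big_split /= (big_morph Posz PoszD (erefl _)).
rewrite lerD2r.
have tauA x : x \in A -> tau x = mu%:Z - r%:Z.
  move=> xA; rewrite /tau (occurrences_common _ xA) -/mu xA.
  by rewrite !(subsetP (common_sub _) _ xA) /=; lia.
have tau_mu x :
    tau x <= mu%:Z - r%:Z + (x \in M u)%:Z + (x \in M v)%:Z - (2 * (x \in A))%N%:Z.
  by rewrite /tau; have := occurrences_le U' x; rewrite -/mu; lia.
have tau_a x : x \notin A -> tau x <= a%:Z.
  move=> xA; have := degree_list_edges_noncommon xA; rewrite degree_list_edges.
  rewrite (occurrences_split W U) [W :&: U]setIC -/U' /tau /r (negbTE xA); lia.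
rewrite (big_setID A) /=.
have -> : \sum_(x in S :&: A) tau x = #|S :&: A|%:Z * (mu%:Z - r%:Z).
  rewrite (eq_bigr (fun=> mu%:Z - r%:Z)) => [|x]; last by rewrite inE => /andP[_ /tauA].
  by rewrite sumr_const -mulr_natl natz.
have SAa : (#|S :&: A| <= a)%N by rewrite subset_leq_card // subsetIr.
set Y := S :\: A.
suff : #|S :&: A|%:Z * (mu%:Z - r%:Z) + \sum_(x in Y) tau x <= (mu * a)%N%:Z by [].
have YA x : x \in Y -> x \notin A by rewrite inE => /andP[].
have tauY : \sum_(x in Y) tau x <= #|Y|%:Z * a%:Z.
  rewrite -[#|Y|%:Z]natz mulr_natl -sumr_const; apply: ler_sum => x /YA; exact: tau_a.
have [mur|rmu] := leqP r mu.
  suff le : \sum_(x in Y) tau x <= r%:Z * a%:Z.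
    have : 0 <= (a%:Z - #|S :&: A|%:Z) * (mu%:Z - r%:Z) by apply: mulr_ge0; lia.
    by lia.
  have [Yr|rY] := leqP #|Y| r.
    apply: le_trans tauY _; apply: ler_wpM2r; lia.
  have sumY : \sum_(x in Y) tau x <= (r * (mu + 2))%N%:Z - #|Y|%:Z * r%:Z.
    have -> : \sum_(x in Y) tau x =
        (\sum_(x in Y) (occurrences U' x + (x \in M u) + (x \in M v)))%N%:Z
        - #|Y|%:Z * r%:Z.
      rewrite (big_morph Posz PoszD (erefl _)) -[#|Y|%:Z]natz mulr_natl -sumr_const -sumrB.
      by apply: eq_bigr => x /YA xA; rewrite /tau (negbTE xA) muln0 subr0.
    rewrite lerD2r lez_nat.
    apply: leq_trans (_ : \sum_(x in ~: A)
        (occurrences U' x + (x \in M u) + (x \in M v)) <= _)%N.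
      rewrite [leqRHS](big_setID Y) /= (setIidPr _) ?leq_addr //.
      by apply/subsetP => x /YA; rewrite in_setC.
    rewrite !big_split /= sum_occurrences.
    have card_noncommon t : #|M t :&: ~: A| = r.
      by rewrite -setDE cardsD (setIidPr (common_sub t)) cardM.
    have memE t : (\sum_(x in ~: A) (x \in M t) = r)%N.
      rewrite -(card_noncommon t) -sum1_card big_mkcond [RHS]big_mkcond.
      by apply: eq_bigr => x _; rewrite !inE andbC; case: ifP => //; case: (x \in M t).
    rewrite !memE (eq_bigr (fun=> r)) // sum_nat_const -/mu; lia.
  have : 0 <= r%:Z * (#|Y|%:Z - r%:Z - 1) by apply: mulr_ge0; lia.
  have : 0 <= r%:Z * (m%:Z - mu%:Z) by apply: mulr_ge0; lia.
  have -> : a%:Z = m%:Z + 1 - r%:Z by rewrite /r; lia.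
  by move: sumY; lia.
have SA0 : #|S :&: A|%:Z * (mu%:Z - r%:Z) <= 0 by apply: mulr_ge0_le0; lia.
suff : \sum_(x in Y) tau x <= (mu * a)%N%:Z by lia.
have [a0|a_gt0] := posnP a; first by move: tauY; rewrite a0 muln0 mulr0.
have [lt|] := ltnP mu.+1 r.
  apply: le_trans (_ : 0 <= _); rewrite // sumr_le0 // => x _.
  by have := tau_mu x; case: (x \in M u); case: (x \in M v); lia.
move=> rmu1; have {rmu rmu1} rE : r = mu.+1 by lia.
have proper_uv : M u :&: M v \proper M u.
  rewrite properE subsetIl subsetI subxx /=; apply: contra Muv => sub.
  by rewrite eqEcard sub !cardM /=.
apply: le_trans (_ : #|(M u :&: M v) :\: A|%:Z <= _); last first.
  have := proper_card proper_uv; have := cardsID A (M u :&: M v).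
  rewrite (setIidPr _) ?subsetI ?common_sub // cardM lez_nat => <- lt.
  by apply: leq_trans (_ : mu <= _)%N; [move: rE; rewrite /r; lia | rewrite leq_pmulr].
rewrite -[#|_|%:Z]natz -sumr_const big_mkcond [leRHS]big_mkcond.
apply: ler_sum => x _; case: (boolP (x \in Y)) => xY; last by case: ifP.
have := tau_mu x; rewrite in_setD in_setI (YA _ xY) (negbTE (YA _ xY)) /=.
by rewrite rE; case: (x \in M u); case: (x \in M v) => /=; lia.
Qed.

Lemma balanced_inner_split :
  exists H : {set T * X},
    [/\ H \subset EW,
        forall t, t \notin [set u; v] -> degree fst H t = a,
        forall x, (degree snd H x + (x \in A) <= a)%N &
        forall x, (degree snd (list_edges M) x <=
                   degree snd H x + 2 * (x \in A) + r)%N].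
Proof.
have am : (a <= m)%N by rewrite -ltnS (card_common_lt Muv).
have [||H [HE HT HX]] := degree_constrained_subgraph _ _ cut_rows cut_columns.
- by [].
- move=> x; rewrite /symbol_lower /symbol_upper; case: (boolP (x \in A)) => xA.
    have := subset_leq_card (common_sub u); rewrite degree_list_edges.
    have := occurrences_le W x; rewrite cardW /r.
    by rewrite !(subsetP (common_sub _) _ xA) /=; lia.
  by have := degree_list_edges_noncommon xA; rewrite /r; lia.
exists H; split=> // [t tW|x|x].
- by have := HT t; rewrite /row_target tW mul1n; lia.
- by have := HX x; rewrite /symbol_upper; lia.
- by have := HX x; rewrite /symbol_lower; lia.
Qed.
End NearComplete.

Section NearCompletePacking.
Local Open Scope nat_scope.

Lemma near_complete_packing (T X : finType) (M : T -> {set X}) (u v : T) k :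
  u != v -> #|T| = k.+1 -> (forall t, #|M t| = k) ->
  exists c : 'I_k -> T -> X,
    [/\ forall i t, c i t \in M t,
        forall i j t, i != j -> c i t != c j t &
        forall i t t', t != t' -> ~~ [&& t \in [set u; v] & t' \in [set u; v]] ->
          c i t != c i t'].
Proof.
move=> uv cardT cardM.
case: k cardT cardM => [|m] cardT cardM.
  have := max_card (mem [set u; v]); rewrite cardT cards2 uv; lia.
have [Muv|Muv] := eqVneq (M u) (M v); last first.
  have am : (#|common M| <= m)%N by rewrite -ltnS (card_common_lt cardM Muv).
  have [H [HE HT HX EX]] := balanced_inner_split uv cardT cardM Muv.
  apply: (two_block_packing uv _ cardM (common_sub M u) (common_sub M v) HE HT HX EX).
  lia.
have Hsnd x : degree snd (inner_edges M u v) x = occurrences M (~: [set u; v]) x.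
  rewrite degree_snd; apply: eq_card => t; rewrite !inE.
  by case: (x \in M t); rewrite ?andbF ?andbT.
have Av : M u \subset M v by rewrite Muv.
have muE : m.+1 = (0 + #|M u|)%N by rewrite cardM.
apply: (two_block_packing uv muE cardM (subxx _) Av (subxx _)).
- move=> t tW; rewrite cardM -(cardM t) degree_fst; apply: eq_card => x.
  by move: tW; rewrite !inE => ->; rewrite andbT.
- move=> x; rewrite Hsnd cardM; have := occurrences_le M (~: [set u; v]) x.
  by rewrite (cardW uv cardT); case: (x \in M u); lia.
- move=> x; rewrite (degree_list_edges M uv) Hsnd -Muv.
  by case: (x \in M u); lia.
Qed.

End NearCompletePacking.

(** * Lists of natural numbers and the list packing number *)

Section ListPacking.
Local Open Scope nat_scope.
Variables (T : finType) (adj : rel T).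

(** Finitely many lists of natural numbers use finitely many colours, so they may
    be taken as sets over a finite type. *)
Lemma list_packable_from_sets k :
  (forall (X : finType) (M : T -> {set X}), (forall t, #|M t| = k) ->
    exists c : 'I_k -> T -> X,
      [/\ forall i t, c i t \in M t,
          forall i j t, i != j -> c i t != c j t &
          forall i t t', adj t t' -> c i t != c i t']) ->
  list_packable adj k.
Proof.
move=> pack L Lk.
pose N := (\max_t \max_(x <- L t) x).+1.
have ltN t x : x \in L t -> x < N.
  move=> xL; rewrite ltnS (leq_trans _ (@leq_bigmax _ (fun t => \max_(x <- L t) x) t)) //.
  exact: (leq_bigmax_seq (F := id)).
have [t|c [cM cd cp]] := pack _ (fun t => [set x : 'I_N | val x \in L t]).
  rewrite -(Lk t) cardE -(size_map val).
  apply/perm_size/uniq_perm; rewrite ?(map_inj_uniq val_inj) ?enum_uniq ?fset_uniq //.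
  move=> x; apply/mapP/idP => [[y] | xL]; first by rewrite mem_enum inE => yL ->.
  by exists (Ordinal (ltN _ _ xL)); rewrite // mem_enum inE.
exists (fun i t => val (c i t)); split.
  move=> i; split=> [t|t t' tt'] /=; first by have := cM i t; rewrite inE.
  by move/val_inj/eqP; apply/negP/cp.
by move=> i j t ij /val_inj/eqP; apply/negP/cd.
Qed.

Lemma list_packable_card : irreflexive adj -> list_packable adj #|T|.
Proof.
move=> irr; apply: list_packable_from_sets => X M cardM.
have [c [cM cd cp]] := complete_packing (erefl _) cardM.
by exists c; split=> // i t t' tt'; apply: cp; apply: contraTneq tt' => ->; rewrite irr.
Qed.

Lemma list_packable_noncomplete k u v :
  symmetric adj -> irreflexive adj -> u != v -> ~~ adj u v -> #|T| = k.+1 ->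
  list_packable adj k.
Proof.
move=> sym irr uv nadj cardT; apply: list_packable_from_sets => X M cardM.
have [c [cM cd cp]] := near_complete_packing uv cardT cardM.
exists c; split=> // i t t' tt'; apply: cp.
  by apply: contraTneq tt' => ->; rewrite irr.
apply: contraTN tt'; rewrite !inE => /andP[/orP[]/eqP-> /orP[]/eqP->]; rewrite ?irr //.
by rewrite sym.
Qed.

(** With the same [j] colours at each vertex, a colouring of a complete graph is
    an injection into these colours. *)
Lemma complete_list_packable_ge j :
  complete_graph adj -> 0 < j -> list_packable adj j -> #|T| <= j.
Proof.
move=> compl; case: j => // j _ /(_ (fun=> [fset x in iota 0 j.+1]%fset)) [|c [cP _]].
  by move=> t; rewrite card_fseq undup_id ?iota_uniq // size_iota.
have [cL cE] := cP ord0.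
have cj t : c ord0 t < j.+1 by have := cL t; rewrite in_fset mem_iota add0n.
rewrite -[X in _ <= X](card_ord j.+1).
apply: (@leq_card _ _ (fun t => Ordinal (cj t))) => t t' [] eqc.
apply/eqP; apply: contraT => /compl /cE; by rewrite eqc.
Qed.

(** Classical, since being packable quantifies over all lists and is not given as
    a decidable property. *)
Lemma least_nat (P : nat -> Prop) n :
  P n -> exists k, P k /\ forall j, P j -> k <= j.
Proof.
elim/ltn_ind: n => n IHn Pn.
have [[j [jn Pj]]|no] := classic (exists j, j < n /\ P j); first exact: IHn jn Pj.
exists n; split=> // j Pj; rewrite leqNgt; apply/negP => jn.
by apply: no; exists j.
Qed.

Lemma list_packing_number_exists j :
  0 < j -> list_packable adj j ->
  exists chi, is_list_packing_number adj chi /\ chi <= j.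
Proof.
move=> j0 pj.
have [chi [[chi0 pchi] min]] :=
  @least_nat (fun i => 0 < i /\ list_packable adj i) j (conj j0 pj).
by exists chi; split; [split=> // i i0 pi; apply: min | apply: min].
Qed.

End ListPacking.

Theorem theorem2 (T : finType) (adj : rel T) (n : nat)
    (adj_sym : symmetric adj) (adj_irr : irreflexive adj)
    (card_T : #|T| = n) (n_gt0 : 0 < n) :
  exists chi : nat,
    is_list_packing_number adj chi /\
    chi <= n /\
    (chi = n <-> complete_graph adj).
Proof.
have pn : list_packable adj n by rewrite -card_T; apply: list_packable_card.
have [chi [chiP chi_n]] := list_packing_number_exists n_gt0 pn.
exists chi; split=> //; split=> //; have [chi0 pchi min] := chiP.
split=> [chiE u v uv|compl].
  apply: contraT => nadj.
  have n_gt1 : 1 < n.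
    rewrite -card_T; have := max_card (mem [set u; v]).
    by rewrite cards2 uv.
  have : chi <= n.-1.
    apply: min; first by rewrite -ltnS prednK.
    by apply: (list_packable_noncomplete adj_sym adj_irr uv nadj); rewrite prednK.
  by rewrite chiE -ltnS prednK // ltnn.
by apply/eqP; rewrite eqn_leq chi_n -card_T (complete_list_packable_ge compl).
Qed.
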